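(* Let $a,b,k$ be nonnegative integers with $b>a\ge k-2$. Then the caterpillars $T_{a,b}$ and $T_{a+1,b-1}$ have the same $k$-deck.
   Context: For nonnegative integers $a,b$, $T_{a,b}$ denotes the tree that is the union of three paths of lengths (numbers of edges) $1$, $a$, and $b$ having one common endpoint and otherwise disjoint; it has $a+b+2$ vertices. The $k$-deck of a graph is the multiset of its $k$-vertex induced subgraphs, each taken up to isomorphism. *)

(* Defs.v *)
From mathcomp Require Import all_boot.
From mathcomp Require Import finmap multiset.

Set Implicit Arguments.
Unset Strict Implicit.
Unset Printing Implicit Defensive.

Local Open Scope mset_scope.
Local Open Scope nat_scope.

Record sgraph := SGraph {
  vertex :> finType;
  adj : rel vertex;
  adj_sym : symmetric adj;
  adj_irr : irreflexive adj }.

Definition isomorphic (G H : sgraph) : Prop :=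
  exists2 f : G -> H, bijective f & {mono f : x y / @adj G x y >-> @adj H x y}.

Section Induced.
Variables (G : sgraph) (A : {set G}).

Definition induced_adj : rel {x : G | x \in A} :=
  fun x y => @adj G (val x) (val y).

Lemma induced_adj_sym : symmetric induced_adj.
Proof. by move=> x y; apply: adj_sym. Qed.

Lemma induced_adj_irr : irreflexive induced_adj.
Proof. by move=> x; apply: adj_irr. Qed.

Definition induced : sgraph := SGraph induced_adj_sym induced_adj_irr.
End Induced.

(* The isomorphism type of a [k]-vertex graph [G], as the set of all graphs with
   vertex set ['I_k] isomorphic to [G], each given by its set of adjacent ordered
   pairs. Lemma [iso_typeP] below: equality of types is isomorphism. *)
Definition iso_type (k : nat) (G : sgraph) : {set {set 'I_k * 'I_k}} :=
  [set [set p : 'I_k * 'I_k | @adj G (f p.1) (f p.2)]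
     | f : {ffun 'I_k -> G} & injectiveb f && (#|G| == k)].

Definition deck (k : nat) (G : sgraph) : {mset {set {set 'I_k * 'I_k}}} :=
  seq_mset [seq iso_type k (induced A) | A in [set A : {set G} | #|A| == k]].

(* The union of [n] paths of lengths [l 0], ..., [l n.-1] sharing one endpoint and
   otherwise disjoint: [None] is the common endpoint, and [Some (Tagged _ j)] with
   tag [i] is the vertex at distance [j.+1] from it on the [i]-th path. *)
Section Spider.
Variables (n : nat) (l : 'I_n -> nat).

Definition spider_adj : rel (option {i : 'I_n & 'I_(l i)}) :=
  fun u v => match u, v with
  | None, None => false
  | None, Some q => tagged q == 0 :> nat
  | Some p, None => tagged p == 0 :> nat
  | Some p, Some q =>
      (tag p == tag q) &&
      (((tagged p).+1 == tagged q :> nat) || ((tagged q).+1 == tagged p :> nat))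
  end.

Lemma spider_adj_sym : symmetric spider_adj.
Proof. by move=> [p|] [q|] //=; rewrite eq_sym orbC. Qed.

Lemma spider_adj_irr : irreflexive spider_adj.
Proof. by move=> [p|] //=; rewrite eqxx orbb gtn_eqF. Qed.

Definition spider : sgraph := SGraph spider_adj_sym spider_adj_irr.
End Spider.

Definition T (a b : nat) : sgraph := spider (tnth [tuple 1; a; b]).

Lemma card_T (a b : nat) : #|T a b| = a + b + 2.
Proof.
rewrite card_option card_tagged sumnE big_map big_enum /=.
by rewrite !big_ord_recl big_ord0 !card_ord /tnth /= addn0 add1n addn2.
Qed.

Lemma iso_typeP (k : nat) (G H : sgraph) :
  #|G| = k -> #|H| = k -> iso_type k G = iso_type k H <-> isomorphic G H.
Proof.
move=> cG cH; split=> [eqGH | [h bijh hE]].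
- pose f := [ffun i : 'I_k => enum_val (cast_ord (esym cG) i) : G].
  have injf : injective f.
    by move=> i j; rewrite !ffunE => /enum_val_inj /cast_ord_inj.
  have : [set p : 'I_k * 'I_k | @adj G (f p.1) (f p.2)] \in iso_type k H.
    rewrite -eqGH; apply/imsetP; exists f => //.
    by rewrite inE cG eqxx andbT; apply/injectiveP.
  case/imsetP=> g; rewrite inE => /andP[/injectiveP injg _] /setP fg.
  have [f' fK f'K] : bijective f by apply: inj_card_bij; rewrite // card_ord cG.
  exists (g \o f').
    apply: bij_comp; last by exists f.
    by apply: inj_card_bij; rewrite // card_ord cH.
  move=> x y /=; have := fg (f' x, f' y).
  by rewrite !inE /= !f'K => ->.
- have [h' hK h'K] := bijh.
  apply/setP=> M; apply/imsetP/imsetP=> -[f].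
  + rewrite inE => /andP[/injectiveP injf _] ->.
    exists [ffun i => h (f i)].
      rewrite inE cH eqxx andbT; apply/injectiveP=> i j.
      by rewrite !ffunE => /(can_inj hK) /injf.
    by apply/setP=> p; rewrite !inE !ffunE hE.
  + rewrite inE => /andP[/injectiveP injf _] ->.
    exists [ffun i => h' (f i)].
      rewrite inE cG eqxx andbT; apply/injectiveP=> i j.
      by rewrite !ffunE => /(can_inj h'K) /injf.
    by apply/setP=> p; rewrite !inE !ffunE -hE !h'K.
Qed.

(* Main.v *)
(** Number the spine of [T a b] by [0, ..., a + b], the leaf hanging from [a];
    then [T (a + 1) (b - 1)] has the same spine, the leaf hanging from [a + 1].
    A vertex set [A] avoiding the leaf induces the same graph in both. If [A]
    contains the leaf and [k <= a + 2] vertices in all, then by pigeonhole there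
    is [t <= a + 1] such that [A] contains neither spine vertex [a - t] nor
    [a + 1 + t] (the former does not exist for [t = a + 1]). Reversing the spine
    strictly between these two, which exchanges [a] and [a + 1], does not change
    the induced graph. Taking the least such [t], this is an involution, because
    reversing preserves every pair [{a - t', a + 1 + t'}]. *)

Require Import Defs.
From mathcomp Require Import all_boot.
From mathcomp Require Import finmap multiset.
From mathcomp Require Import zify.

Set Implicit Arguments.
Unset Strict Implicit.
Unset Printing Implicit Defensive.

(** * Comparing decks through maps of vertex sets *)

Lemma induced_imset (G H : sgraph) (g : G -> H) (A : {set G}) :
  {in A &, injective g} -> {in A &, {mono g : x y / adj x y}} ->
  isomorphic (induced A) (induced (g @: A)).
Proof.
move=> injg monog.
pose f (x : induced A) : induced (g @: A) :=
  Sub (g (val x)) (imset_f g (valP x)).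
exists f; last by move=> x y; apply: monog; apply: valP.
apply: inj_card_bij => [x y [] /injg eqxy|].
  by apply/val_inj/eqxy; apply: valP.
by rewrite !card_sig -(card_in_imset injg).
Qed.

Lemma isomorphic_card (G H : sgraph) : isomorphic G H -> #|G| = #|H|.
Proof. by case=> f /bij_eq_card. Qed.

(** Graphs of equal order have equally many [k]-sets, so the injection [F] is onto the [k]-sets of
    [H]; it then matches the two decks card by card. *)
Lemma eq_deck (k : nat) (G H : sgraph) (F : {set G} -> {set H}) :
  #|G| = #|H| -> {in [set A : {set G} | #|A| == k] &, injective F} ->
  (forall A : {set G}, #|A| = k -> isomorphic (induced A) (induced (F A))) ->
  deck k G = deck k H.
Proof.
move=> cGH injF isoF.
have cF (A : {set G}) : #|A| = k -> #|F A| = k.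
  by move=> cA; have := isomorphic_card (isoF A cA); rewrite !card_sig cA.
have FE : F @: [set A : {set G} | #|A| == k] = [set B : {set H} | #|B| == k].
  apply/eqP; rewrite eqEcard card_in_imset // !card_draws cGH leqnn andbT.
  by apply/subsetP=> _ /imsetP[A + ->]; rewrite !inE => /eqP/cF->.
apply/eq_seq_msetP; rewrite -FE.
have eF : perm_eq (map F (enum [set A : {set G} | #|A| == k]))
                  (enum (F @: [set A : {set G} | #|A| == k])).
  apply: uniq_perm; [|exact: enum_uniq|].
    rewrite map_inj_in_uniq ?enum_uniq // => A B.
    by rewrite !mem_enum; apply: injF.
  move=> B; rewrite mem_enum; apply/mapP/imsetP => -[A kA ->]; exists A => //.
    by rewrite mem_enum in kA.
  by rewrite mem_enum.
rewrite /image_mem -(permPr (perm_map _ eF)) -map_comp.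
rewrite (_ : map _ _ = map ((fun B => iso_type k (induced B)) \o F)
               (enum [set A : {set G} | #|A| == k])) //.
apply/eq_in_map=> A; rewrite mem_enum inE => /eqP cA /=.
by apply/iso_typeP; rewrite ?card_sig ?cF //; apply: isoF.
Qed.

Lemma isomorphic_deck (k : nat) (G H : sgraph) :
  isomorphic G H -> deck k G = deck k H.
Proof.
move=> isoGH; have cGH := isomorphic_card isoGH; case: isoGH => f bijf monof.
have injf := bij_inj bijf.
apply: (@eq_deck _ _ _ (fun A => f @: A)) => // [A B _ _|A _].
  exact: imset_inj.
by apply: induced_imset => x y _ _; [apply: injf|apply: monof].
Qed.

(** Spine [0, ..., n.-1], with the leaf [n] attached to the spine vertex [p]. *)
Section Caterpillar.
Variables n p : nat.

Definition cat_adj : rel 'I_n.+1 := fun i j =>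
  [|| (i.+1 == j) && (j < n), (j.+1 == i) && (i < n),
      [&& i == n :> nat, j < n & j == p :> nat] |
      [&& j == n :> nat, i < n & i == p :> nat]].

Lemma cat_adj_sym : symmetric cat_adj.
Proof. by move=> i j; rewrite /cat_adj; lia. Qed.

Lemma cat_adj_irr : irreflexive cat_adj.
Proof. by move=> i; rewrite /cat_adj; lia. Qed.

Lemma cat_adj_spine (i j : 'I_n.+1) : i < n -> j < n ->
  cat_adj i j = (i.+1 == j) || (j.+1 == i).
Proof.
move=> lin ljn.
by rewrite /cat_adj lin ljn !andbT (ltn_eqF lin) (ltn_eqF ljn) /= orbF.
Qed.

Lemma cat_adj_leaf (j : 'I_n.+1) : j < n -> cat_adj ord_max j = (j == p :> nat).
Proof. by move=> ljn; rewrite /cat_adj /= ltnn; lia. Qed.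

Definition caterpillar : sgraph := SGraph cat_adj_sym cat_adj_irr.
End Caterpillar.

Definition T_pos (a b : nat) (u : T a b) : nat :=
  match u with
  | None => a
  | Some p => match tag p : nat with
              | 0 => (a + b).+1
              | 1 => a - (tagged p).+1
              | _ => a + (tagged p).+1
              end
  end.

(** Keeping [n] free lets both trees be mapped to caterpillars on literally the same type
    ['I_n.+1]. *)
Lemma T_caterpillar (a b n : nat) :
  n = (a + b).+1 -> isomorphic (T a b) (caterpillar n a).
Proof.
move=> nE.
have pos_lt (u : T a b) : T_pos u < n.+1.
  rewrite nE; case: u => [[[i lti] [j ltj]]|] /=; last by lia.
  by move: i lti ltj => [|[|[|//]]] lti; rewrite /tnth /=; lia.
pose f (u : T a b) : caterpillar n a := Ordinal (pos_lt u).
exists f.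
  apply: inj_card_bij; last by rewrite card_T card_ord nE; lia.
  move=> u v /(congr1 val) /=.
  case: u v => [[[i lti] [j ltj]]|] [[[i' lti'] [j' ltj']]|] //=; last 2 first.
  - by move: i lti ltj => [|[|[|//]]] lti; rewrite /tnth /=; lia.
  - by move: i' lti' ltj' => [|[|[|//]]] lti'; rewrite /tnth /=; lia.
  (* The legs occupy disjoint ranges: below [a], from [a + 1] to [a + b], and the single number
     [a + b + 1]. *)
  move=> eq_pos; have eqi : i = i'.
    move: i i' lti lti' ltj ltj' eq_pos => [|[|[|//]]] [|[|[|//]]] lti lti';
      by rewrite /tnth /=; lia.
  move: eqi lti' ltj' eq_pos => <- lti'.
  rewrite (bool_irrelevance lti' lti) => ltj' eq_pos.
  congr (Some (Tagged _ _)); apply: val_inj => /=.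
  move: i lti {lti'} ltj ltj' eq_pos => [|[|[|//]]] lti;
    by rewrite /tnth /=; lia.
move=> [[[i lti] [j ltj]]|] [[[i' lti'] [j' ltj']]|]; rewrite /= /cat_adj /= nE.
- rewrite -val_eqE /=.
  move: i i' lti lti' ltj ltj' => [|[|[|//]]] [|[|[|//]]] lti lti';
    by rewrite /tnth /=; lia.
- by move: i lti ltj => [|[|[|//]]] lti; rewrite /tnth /=; lia.
- by move: i' lti' ltj' => [|[|[|//]]] lti'; rewrite /tnth /=; lia.
by lia.
Qed.

(** * Reversing a segment of the spine *)

Section Flip.
Variables a b : nat.
Hypothesis ltab : a < b.
Local Notation n := (a + b).+1.

(** The reversed segment runs from [a + 1 - t] to [a + t]. For [t <= a + 1] it ends before the leaf,
    as [2a + 1 < n] by [a < b]. *)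
Definition flip (t : nat) (i : 'I_n.+1) : 'I_n.+1 :=
  if (a < i + t) && (i <= a + t) then inord (a.*2.+1 - i) else i.

Lemma val_flip (t : nat) (i : 'I_n.+1) : t <= a.+1 ->
  flip t i = (if (a < i + t) && (i <= a + t) then a.*2.+1 - i else i) :> nat.
Proof.
by move=> tb; rewrite /flip; case: ifP => // it; rewrite inordK //; lia.
Qed.

Lemma flip_leaf (t : nat) : t <= a.+1 -> flip t ord_max = ord_max.
Proof. by move=> tb; apply: val_inj; rewrite /= val_flip //=; case: ifP; lia. Qed.

Lemma flipK (t : nat) : t <= a.+1 -> involutive (flip t).
Proof.
move=> tb i; apply: val_inj; rewrite /= !val_flip //.
by case it: ((a < i + t) && (i <= a + t)); case: ifP; lia.
Qed.

(** The guard [i < n] matters when [a + 1 + t = n], which is the leaf's number and not a spine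
    vertex. *)
Definition cut (A : {set 'I_n.+1}) (t : nat) : bool :=
  [forall i in A, (i < n) ==> (i + t != a) && (i != a.+1 + t :> nat)].

(** Since [i] goes to [2a + 1 - i], the vertices [a - s] and [a + 1 + s] are either swapped or both
    fixed. One implication gives the other by involutivity. *)
Lemma cut_flip (A : {set 'I_n.+1}) (t s : nat) : t <= a.+1 ->
  cut (flip t @: A) s = cut A s.
Proof.
move=> tb.
have sub B : cut B s -> cut (flip t @: B) s.
  move=> /forall_inP cB; apply/forall_inP => _ /imsetP[i iB ->].
  have := cB i iB; rewrite val_flip //; case: ifP; lia.
apply/idP/idP => [/sub|]; last exact: sub.
rewrite -imset_comp (eq_imset (g := id)) ?imset_id // => i.
exact: flipK.
Qed.

(** Without the leaf nothing has to move, and [flip 0] is the identity. *)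
Definition radius (A : {set 'I_n.+1}) : nat :=
  if ord_max \in A then find (cut A) (iota 0 a.+2) else 0.

Lemma exists_cut (A : {set 'I_n.+1}) : #|A| <= a + 2 -> ord_max \in A ->
  has (cut A) (iota 0 a.+2).
Proof.
move=> cA leafA; apply/negPn/negP => /hasPn ncut.
have /fin_all_exists[h hP] (t : 'I_a.+2) :
    exists i, (i \in A :\ ord_max) && ((i + t == a) || (i == a.+1 + t :> nat)).
  have /ncut : nat_of_ord t \in iota 0 a.+2 by rewrite mem_iota ltn_ord.
  rewrite negb_forall_in => /exists_inP[i iA].
  rewrite negb_imply => /andP[lin it].
  exists i; rewrite !inE iA -val_eqE /=; lia.
(* The pairs for distinct [t] are disjoint, so [a + 2] distinct vertices would lie in [A] minus the
   leaf, which has at most [a + 1]. *)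
have injh : injective h.
  move=> s t eqh; apply: val_inj => /=.
  have /andP[_ hs] := hP s; have /andP[_ ht] := hP t; rewrite eqh in hs; lia.
have : #|h @: setT| <= #|A :\ ord_max|.
  by apply/subset_leq_card/subsetP => _ /imsetP[t _ ->]; case/andP: (hP t).
rewrite card_imset // cardsT card_ord.
by move: cA; rewrite (cardsD1 ord_max A) leafA addn2 add1n ltnS ltnNge => ->.
Qed.

Lemma radius_cut (A : {set 'I_n.+1}) : #|A| <= a + 2 ->
  radius A <= a.+1 /\ (ord_max \in A -> cut A (radius A)).
Proof.
move=> cA; rewrite /radius; case: ifP => // leafA.
have hasA := exists_cut cA leafA.
have := hasA; rewrite has_find size_iota => lt_find.
split => [|_]; first by lia.
by have := nth_find 0 hasA; rewrite nth_iota.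
Qed.

Definition flip_set (A : {set 'I_n.+1}) := flip (radius A) @: A.

Lemma radius_flip (A : {set 'I_n.+1}) : #|A| <= a + 2 ->
  radius (flip_set A) = radius A.
Proof.
move=> /radius_cut[rA _].
have leafA_eq : (ord_max \in flip_set A) = (ord_max \in A).
  by rewrite -{1}(flip_leaf rA) mem_imset //; apply/can_inj/flipK.
by rewrite /radius leafA_eq; case: ifP => // _;
  apply: eq_find => s; apply: cut_flip.
Qed.

Lemma flip_setK (A : {set 'I_n.+1}) : #|A| <= a + 2 ->
  flip_set (flip_set A) = A.
Proof.
move=> cA; have [rA _] := radius_cut cA.
rewrite {1}/flip_set radius_flip // -imset_comp.
by rewrite (eq_imset (g := id)) ?imset_id // => i; apply: flipK.
Qed.

Lemma ord_leaf_or_spine (i : 'I_n.+1) : i = ord_max \/ i < n.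
Proof.
have := ltn_ord i; rewrite ltnS leq_eqVlt => /orP[/eqP iE|]; last by right.
by left; apply: val_inj.
Qed.

Lemma flip0 (i : 'I_n.+1) : flip 0 i = i.
Proof. by rewrite /flip !addn0 ltnNge andNb. Qed.

(** The two spine vertices bordering the segment are missing from [A], so no edge within [A] joins
    its inside to the rest of the spine. For [t = 0] they are [a] and [a + 1], so the leaf is
    isolated in both graphs. *)
Lemma flip_adj (A : {set 'I_n.+1}) (t : nat) : t <= a.+1 -> cut A t ->
  {in A &, forall i j, cat_adj a.+1 (flip t i) (flip t j) = cat_adj a i j}.
Proof.
move=> tb /forall_inP cutA.
have spine_flip (i : 'I_n.+1) : i < n -> flip t i < n.
  by move=> lin; rewrite val_flip //; case: ifP => // _; lia.
have leaf_spine j : j \in A -> j < n ->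
    cat_adj a.+1 (flip t ord_max) (flip t j) = cat_adj a ord_max j.
  move=> jA ljn; rewrite flip_leaf // !cat_adj_leaf ?spine_flip // val_flip //.
  have := cutA j jA; rewrite ljn /= => /andP[/eqP ? /eqP ?].
  by case: ifP => [/andP[? ?]|/negbT/nandP ?]; apply/eqP/eqP; lia.
move=> i j iA jA; have [-> {i iA}|lin] := ord_leaf_or_spine i.
  have [->|ljn] := ord_leaf_or_spine j; last exact: leaf_spine.
  by rewrite !cat_adj_irr.
have [->|ljn] := ord_leaf_or_spine j.
  by rewrite cat_adj_sym leaf_spine // cat_adj_sym.
rewrite !cat_adj_spine ?spine_flip // !val_flip //.
have := cutA i iA; rewrite lin /= => /andP[/eqP i_a /eqP i_a1].
have := cutA j jA; rewrite ljn /= => /andP[/eqP j_a /eqP j_a1].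
(* Inside the segment, reversal exchanges successor and predecessor; in the mixed cases neither side
   has an edge. *)
case: ifP => [/andP[ati tai]|/negbT/nandP outi];
  case: ifP => [/andP[atj taj]|/negbT/nandP outj] //.
- by rewrite orbC; congr (_ || _); apply/eqP/eqP; lia.
- by congr (_ || _); apply/eqP/eqP; lia.
- by congr (_ || _); apply/eqP/eqP; lia.
Qed.

Lemma flip_set_iso (A : {set 'I_n.+1}) : #|A| <= a + 2 ->
  isomorphic (@induced (caterpillar n a) A)
             (@induced (caterpillar n a.+1) (flip_set A)).
Proof.
move=> cA; have [rA cutA] := radius_cut cA.
apply: (@induced_imset (caterpillar n a) (caterpillar n a.+1)).
  by move=> i j _ _; apply/can_inj/flipK.
have [leafA|leafA] := boolP (ord_max \in A).
  by apply: flip_adj => //; apply: cutA.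
have spineA i : i \in A -> i < n.
  by case: (ord_leaf_or_spine i) => // ->; rewrite (negPf leafA).
move=> i j /spineA lin /spineA ljn.
by rewrite /radius (negPf leafA) !flip0 /= !cat_adj_spine.
Qed.

Lemma deck_caterpillar (k : nat) : k <= a + 2 ->
  deck k (caterpillar n a) = deck k (caterpillar n a.+1).
Proof.
move=> hk.
apply: (@eq_deck _ (caterpillar n a) (caterpillar n a.+1) flip_set) => //.
  apply: (can_in_inj (g := flip_set)) => A; rewrite inE => /eqP cA.
  by apply: flip_setK; rewrite cA.
by move=> A cA; apply: flip_set_iso; rewrite cA.
Qed.
End Flip.

Theorem theorem1p6 (a b k : nat) (hab : a < b) (hk : k <= a + 2) :
  deck k (T a b) = deck k (T (a + 1) (b - 1)).
Proof.
rewrite (isomorphic_deck k (T_caterpillar (erefl (a + b).+1))).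
rewrite (deck_caterpillar hab hk) addn1.
apply/esym/isomorphic_deck/T_caterpillar.
(* The spines have equal length since [a < b] makes [b] positive. *)
by lia.
Qed.
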